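(* There is no finite constant $C$ such that $$\int_{T^2}\mathbb V^\nu_\varepsilon\,d\nu\le C\,\varepsilon\,|\nu|$$ holds for all $N\ge1$, all measures $\nu$ on the bi-tree $T^2=T_N\times T_N$ and all $\varepsilon>0$. That is, for every $C<\infty$ there exist $N\ge1$, a measure $\nu$ on $T^2=T_N\times T_N$ and $\varepsilon>0$ with $\int_{T^2}\mathbb V^\nu_\varepsilon\,d\nu>C\varepsilon|\nu|$.
   Context: For an integer $N\ge1$, $T=T_N$ denotes the finite rooted dyadic tree whose vertices are the dyadic subintervals of $[0,1]$ of length $2^{-k}$, $0\le k\le N$, ordered by inclusion. The bi-tree $T^2=T\times T$ has as vertices the dyadic rectangles $R=I\times J$ with $I,J\in T$, ordered by inclusion: $\alpha\le\alpha'$ iff the rectangle $\alpha$ is contained in the rectangle $\alpha'$. Its boundary $\partial T^2$ is the set of dyadic squares of size $2^{-N}\times2^{-N}$. For $f:T^2\to[0,\infty)$ put $\mathbb I f(\alpha)=\sum_{\alpha'\ge\alpha}f(\alpha')$ and $\mathbb I^* f(\alpha)=\sum_{\alpha'\le\alpha}f(\alpha')$. A measure on $T^2$ is a function $\nu:T^2\to[0,\infty)$ that vanishes outside $\partial T^2$; $|\nu|=\sum_{\alpha}\nu(\alpha)$ is its total mass and $\int_{T^2}u\,d\nu=\sum_\alpha u(\alpha)\nu(\alpha)$. Its potential is $\mathbb V^\nu=\mathbb I(\mathbb I^*\nu)$. For $\varepsilon>0$ let $E_\varepsilon=\{\alpha\in T^2:\mathbb V^\nu(\alpha)\le\varepsilon\}$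 and $\mathbb V^\nu_\varepsilon=\mathbb I(\mathbf 1_{E_\varepsilon}\,\mathbb I^*\nu)$; thus $\int_{T^2}\mathbb V^\nu_\varepsilon\,d\nu=\sum_{\alpha\in E_\varepsilon}(\mathbb I^*\nu(\alpha))^2$. *)

(* Defs.v *)
From mathcomp Require Import all_boot all_order all_algebra.
From mathcomp Require Import reals.

Set Implicit Arguments.
Unset Strict Implicit.
Unset Printing Implicit Defensive.

Import Order.TTheory GRing.Theory Num.Theory.
Local Open Scope ring_scope.

(* The vertex (k, j), with k <= N and j < 2 ^ k, stands for the dyadic
   interval [j / 2 ^ k, (j + 1) / 2 ^ k] of length 2 ^ - k. *)
Notation dyadic N := {k : 'I_N.+1 & 'I_(2 ^ k)}.

Definition dyadic_itv N (I : dyadic N) : interval rat :=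
  `[(tagged I)%:R / 2 ^+ tag I, (tagged I).+1%:R / 2 ^+ tag I].

Notation bitree N := (dyadic N * dyadic N)%type.

(* The order on [interval rat] is inclusion; as the sides of a dyadic rectangle
   are nonempty, rectangles are included in one another iff both sides are
   (see [bitree_leP]). *)
Definition bitree_le N (a b : bitree N) : bool :=
  (dyadic_itv a.1 <= dyadic_itv b.1)%O && (dyadic_itv a.2 <= dyadic_itv b.2)%O.

Definition rectangle N (a : bitree N) : pred (rat * rat) :=
  [pred x | (x.1 \in dyadic_itv a.1) && (x.2 \in dyadic_itv a.2)].

Lemma dyadic_itv_bounds N (I : dyadic N) :
  (tagged I)%:R / 2 ^+ tag I <= (tagged I).+1%:R / 2 ^+ tag I :> rat.
Proof. by rewrite ler_pM2r ?invr_gt0 ?exprn_gt0 // ler_nat. Qed.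

Lemma bitree_leP N (a b : bitree N) :
  reflect {subset rectangle a <= rectangle b} (bitree_le a b).
Proof.
apply: (iffP andP) => [[le1 le2] x|sub].
  case/andP=> x1 x2; apply/andP; split; [exact: subitvP x1 | exact: subitvP x2].
have h1 := dyadic_itv_bounds a.1; have h2 := dyadic_itv_bounds a.2.
set l1 := _ / _ in h1; set r1 := _ / _ in h1.
set l2 := _ / _ in h2; set r2 := _ / _ in h2.
have /sub/andP[] : (l1, l2) \in rectangle a.
  by apply/andP; split; rewrite /= in_itv /= lexx.
rewrite /= !in_itv /= => /andP[lb1 _] /andP[lb2 _].
have /sub/andP[] : (r1, r2) \in rectangle a.
  by apply/andP; split; rewrite /= in_itv /= lexx andbT.
rewrite /= !in_itv /= => /andP[_ ub1] /andP[_ ub2].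
by rewrite !subitvE /= !bnd_simp; split; apply/andP.
Qed.

Definition boundary (N : nat) : {set bitree N} :=
  [set a : bitree N | (tag a.1 == N :> nat) && (tag a.2 == N :> nat)].

Section Potential.
Variables (R : realType) (N : nat).
Implicit Types (f u nu : bitree N -> R).

Definition hardy f (a : bitree N) : R := \sum_(b | bitree_le a b) f b.

Definition hardy_dual f (a : bitree N) : R := \sum_(b | bitree_le b a) f b.

Definition is_measure nu : Prop :=
  (forall a, 0 <= nu a) /\ (forall a, a \notin boundary N -> nu a = 0).

Definition mass nu : R := \sum_a nu a.

Definition integral u nu : R := \sum_a u a * nu a.

Definition potential nu : bitree N -> R := hardy (hardy_dual nu).

Definition sublevel nu (eps : R) : {set bitree N} :=
  [set a | potential nu a <= eps].

Definition truncated_potential nu (eps : R) : bitree N -> R :=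
  hardy (fun a => (a \in sublevel nu eps)%:R * hardy_dual nu a).

End Potential.

(* Main.v *)
Require Import Defs.
From mathcomp Require Import all_boot all_order all_algebra.
From mathcomp Require Import reals.
Import Order.TTheory GRing.Theory Num.Theory.
Local Open Scope ring_scope.

(** A unit point mass already defeats every constant.  Let [nu] be the unit
    mass at the boundary square touching the origin.  The rectangles containing
    that square are [0, 2^-i] x [0, 2^-j] with 0 <= i, j <= N; each has mass 1,
    and each is contained in exactly (i + 1)(j + 1) of them, so its potential is
    (i + 1)(j + 1) ([potential_corner]).  With eps = N + 1 the truncated
    integral is therefore the number of pairs of positive integers with product
    at most N + 1 ([integral_corner]): the summatory function of the number of
    divisors, of order (N + 1) log (N + 1) ([hyperbola_count]), whereas
    eps |nu| = N + 1.  On a single tree the same sum would count the i with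
    i <= eps only; the logarithm appears because the admissible pairs (i, j)
    fill the region under a hyperbola. *)

Lemma pow2_gt0 k : (0 < 2 ^ k)%N.
Proof. by rewrite expn_gt0. Qed.

Definition corner {N} (i : 'I_N.+1) : dyadic N :=
  existT (fun k : 'I_N.+1 => 'I_(2 ^ k)) i (Ordinal (pow2_gt0 i)).

Definition corner2 {N} (p : 'I_N.+1 * 'I_N.+1) : bitree N :=
  (corner p.1, corner p.2).

(** The closed interval of index [j] at its level reaches the origin only when
    [j = 0], so the ancestors of a corner interval are corner intervals. *)
Lemma corner_le N (i : 'I_N.+1) (J : dyadic N) :
  (dyadic_itv (corner i) <= dyadic_itv J)%O
    = (J == corner (tag J)) && (tag J <= i)%N.
Proof.
case: J => k j; rewrite /dyadic_itv subitvE !bnd_simp /= mul0r.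
have -> : (j%:R / 2 ^+ k <= 0 :> rat) = (j == Ordinal (pow2_gt0 k)).
  by rewrite pmulr_lle0 ?invr_gt0 ?exprn_gt0 // lern0.
rewrite /corner eq_Tagged /=; case: eqP => //= ->.
by rewrite !mul1r lef_pV2 ?posrE ?exprn_gt0 // ler_eXn2l ?ltr1n.
Qed.

Lemma bitree_le_corner2 N (p q : 'I_N.+1 * 'I_N.+1) :
  bitree_le (corner2 p) (corner2 q) = (q.1 <= p.1)%N && (q.2 <= p.2)%N.
Proof. by rewrite /bitree_le !corner_le /= !eqxx. Qed.

Section PointMass.
Variables (R : realType) (N : nat).

Lemma hardy_corner (f : bitree N -> R) (p : 'I_N.+1 * 'I_N.+1) :
  hardy f (corner2 p)
    = \sum_(q : 'I_N.+1 * 'I_N.+1 | (q.1 <= p.1)%N && (q.2 <= p.2)%N) f (corner2 q).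
Proof.
rewrite /hardy (reindex_onto corner2 (fun b => (tag b.1, tag b.2))) /=.
  by apply: eq_bigl => -[k l]; rewrite bitree_le_corner2 eqxx andbT.
case=> b1 b2; rewrite /bitree_le !corner_le /=.
by case/andP=> /andP[/eqP e1 _] /andP[/eqP e2 _]; rewrite /corner2 /= -e1 -e2.
Qed.

Definition origin : bitree N := corner2 (ord_max, ord_max).

Definition point_mass (a : bitree N) : R := (a == origin)%:R.

Lemma point_mass_is_measure : is_measure point_mass.
Proof.
split=> a; first exact: ler0n.
by rewrite /point_mass; case: (a =P origin) => // ->; rewrite inE /= eqxx.
Qed.

Lemma integral_point_mass u : integral u point_mass = u origin.
Proof.
rewrite /integral (bigD1 origin) //= big1 => [|a /negPf na].
  by rewrite /point_mass eqxx mulr1 addr0.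
by rewrite /point_mass na mulr0.
Qed.

Lemma mass_point_mass : mass point_mass = 1.
Proof.
by rewrite -(integral_point_mass (fun=> 1)); apply: eq_bigr => a _; rewrite mul1r.
Qed.

Lemma hardy_dual_corner p : hardy_dual point_mass (corner2 p) = 1.
Proof.
rewrite /hardy_dual (bigD1 origin) /=; last first.
  by rewrite bitree_le_corner2 /= !leq_ord.
rewrite {1}/point_mass eqxx big1 ?addr0 // => a /andP[_ /negPf na].
by rewrite /point_mass na.
Qed.

Lemma potential_corner (p : 'I_N.+1 * 'I_N.+1) :
  potential point_mass (corner2 p) = (p.1.+1 * p.2.+1)%:R.
Proof.
have count_le (i : 'I_N.+1) : (\sum_(k < N.+1 | (k <= i)%N) 1 = i.+1)%N.
  by rewrite -[RHS]card_ord -sum1_card (big_ord_widen N.+1 (fun=> 1%N)).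
rewrite /potential hardy_corner -(count_le p.1) -(count_le p.2) big_distrlr /=.
rewrite pair_big natr_sum; apply: eq_bigr => q _; exact: hardy_dual_corner.
Qed.

Lemma integral_corner (n : nat) :
  integral (truncated_potential point_mass n%:R) point_mass
    = (\sum_(i < N.+1) \sum_(j < N.+1) (i.+1 * j.+1 <= n))%:R.
Proof.
rewrite integral_point_mass /truncated_potential hardy_corner pair_big natr_sum.
apply: eq_big => [q|q _]; first by rewrite /= !leq_ord.
by rewrite hardy_dual_corner mulr1 inE potential_corner ler_nat.
Qed.

End PointMass.

(** The 2^m divisors d with 2^m < d <= 2^(m+1) contribute at least
    2^m * 2^(k-m-1) = 2^(k-1) to the sum of the quotients of 2^k; doubling the
    sum avoids the exponent k - 1, which truncates at k = 0. *)
Lemma harmonic_sum_dyadic k m : (m <= k)%N ->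
  (m * 2 ^ k <= (\sum_(0 <= i < 2 ^ m) 2 ^ k %/ i.+1).*2)%N.
Proof.
elim: m => // m IHm lt_mk; have {}IHm := IHm (ltnW lt_mk).
have le2 : (2 ^ m <= 2 ^ m.+1)%N by rewrite leq_exp2l.
rewrite (big_cat_nat (n := 2 ^ m)) //= doubleD mulSn addnC.
apply: leq_add => //.
have def2k : (2 ^ k = (2 ^ m * 2 ^ (k - m.+1)).*2)%N.
  by rewrite -expnD -mul2n -expnS -addnS subnSK // subnKC // ltnW.
have size_block : (2 ^ m.+1 - 2 ^ m = 2 ^ m)%N.
  by rewrite expnS mul2n -addnn addnK.
rewrite {1}def2k leq_double -{1}size_block -sum_nat_const_nat !big_nat.
apply: leq_sum => i /andP[_ lt_i].
by rewrite leq_divRL // (leq_trans (leq_mul (leqnn _) lt_i)) // -expnD subnK.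
Qed.

(** For each [i], the number of [j] under the hyperbola is the quotient of
    2^k by [i.+1]. *)
Lemma hyperbola_count k :
  (k * 2 ^ k <= (\sum_(i < 2 ^ k) \sum_(j < 2 ^ k) (i.+1 * j.+1 <= 2 ^ k)).*2)%N.
Proof.
apply: leq_trans (harmonic_sum_dyadic k k (leqnn k)) _.
rewrite leq_double big_mkord; apply: leq_sum => i _.
rewrite -{1}[(_ %/ _)%N]muln1 -{1}[(_ %/ _)%N]card_ord -sum_nat_const.
rewrite (big_ord_widen (2 ^ k) (fun=> 1%N)) ?leq_div // big_mkcond /=.
apply: leq_sum => j _; case: ifP => // lt_j.
by rewrite mulnC -leq_divRL // lt_j.
Qed.

Theorem mainTheorem3 (R : realType) :
  forall C : R, exists (N : nat) (nu : bitree N -> R) (eps : R),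
    [/\ (1 <= N)%N, is_measure nu, 0 < eps
      & integral (truncated_potential nu eps) nu > C * eps * mass nu].
Proof.
move=> C; set B := Num.bound `|C|.
have ltCB : C < B%:R by apply: le_lt_trans (ler_norm C) (archi_boundP (normr_ge0 C)).
have B_gt0 : (0 < B)%N.
  by rewrite -(ltr_nat R) (le_lt_trans (normr_ge0 C)) ?archi_boundP.
(* The ratio of the two sides is at least k / 2 when N + 1 = 2 ^ k. *)
set k := B.*2; set N := (2 ^ k).-1.
have defN : N.+1 = (2 ^ k)%N by rewrite prednK ?pow2_gt0.
have N_gt0 : (1 <= N)%N.
  by rewrite -ltnS defN -[1%N]/(2 ^ 0)%N ltn_exp2l // double_gt0.
exists N, (@point_mass R N), N.+1%:R; split=> //.
  exact: point_mass_is_measure.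
rewrite mass_point_mass mulr1 integral_corner.
apply: (@lt_le_trans _ _ (B * N.+1)%:R).
  by rewrite natrM ltr_pM2r ?ltr0n.
by rewrite ler_nat defN -leq_double doubleMl hyperbola_count.
Qed.
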